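(* Let $G$ be a finite simple connected graph with at least two edges. Then the matching complex $M(G)$ is a connected graph if and only if $G$ is (up to isomorphism) in one of the families $\mathcal{G}_1$, $\mathcal{G}_2$, $\mathcal{G}_3$, or $G$ is the bowtie graph $B$.
   Context: A matching in $G$ is a set of edges no two of which share an endpoint. $M(G)$ is the simplicial complex whose faces are all matchings of $G$ (its vertices are the edges of $G$). ''$M(G)$ is a connected graph'' means that $M(G)$ is a simplicial complex of dimension at most one (no matching of size 3 exists in $G$) that is connected. Each family below is taken up to isomorphism and given by: vertices, required edges, optional edges (any subset may be included), and a set $U$ of vertices; one may moreover add any finite number (possibly zero) of new vertices, each joined to some nonempty subset of $U$ (and having no other neighbors). $\mathcal{G}_1$: vertices $1,\dots,5$; required $12,23,34,45$; optional $14,25$; $U=\{2,4\}$. $\mathcal{G}_2$: vertices $1,\dots,5$; required $12,23,13,34,45$; optional $14,24$; $U=\{4\}$. $\mathcal{G}_3$: vertices $1,\dots,5$; required $12,23,34,45,51$; optional $13,35,25,24,14$; $U=\emptyset$. Bowtie graph $B$: vertices $1,\dots,5$, edges $12,23,13,34,45,35$. *)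

(* Defs.v *)
From mathcomp Require Import all_boot.

Set Implicit Arguments.
Unset Strict Implicit.
Unset Printing Implicit Defensive.

(** A finite simple graph is a symmetric irreflexive relation on a finType. *)

Definition graph_connected (T : finType) (e : rel T) : Prop :=
  forall x y, connect e x y.

Definition edge_set (T : finType) (e : rel T) : {set {set T}} :=
  [set [set p.1; p.2] | p : T * T & e p.1 p.2].

Definition graph_iso (T T' : finType) (e : rel T) (e' : rel T') : Prop :=
  exists2 f : T -> T', bijective f & forall x y, e' (f x) (f y) = e x y.

(** A simplicial complex is given by its set of faces (the empty face
    included); [v] is a vertex of [K] when [[set v] \in K]. *)

Definition complex_dim_le (V : finType) (K : {set {set V}}) (d : nat) : Prop :=
  forall s, s \in K -> #|s| <= d.+1.

(* Path-connectedness of the 1-skeleton; the complex without vertices counts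
   as connected. *)
Definition complex_connected (V : finType) (K : {set {set V}}) : Prop :=
  forall v w, [set v] \in K -> [set w] \in K ->
    connect [rel a b | [set a; b] \in K] v w.

Definition is_connected_graph (V : finType) (K : {set {set V}}) : Prop :=
  complex_dim_le K 1 /\ complex_connected K.

Definition is_matching (T : finType) (e : rel T) (M : {set {set T}}) : bool :=
  (M \subset edge_set e) && trivIset M.

Definition matching_complex (T : finType) (e : rel T) : {set {set {set T}}} :=
  [set M | is_matching e M].

Lemma matching_complexS (T : finType) (e : rel T) (M N : {set {set T}}) :
  N \subset M -> M \in matching_complex e -> N \in matching_complex e.
Proof.
move=> sNM; rewrite !inE => /andP[sM tM].
by rewrite /is_matching (subset_trans sNM sM) (trivIsetS sNM tM).
Qed.

Lemma matching_complex_vertex (T : finType) (e : rel T) (a : {set T}) :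
  ([set a] \in matching_complex e) = (a \in edge_set e).
Proof. by rewrite inE /is_matching sub1set trivIset1 andbT. Qed.

(** Graphs on the vertices 1, ..., 5 are described by lists of edges [(i, j)];
    the element [i : 'I_5] stands for the vertex [i.+1]. *)

Definition edges_rel (s : seq (nat * nat)) : rel 'I_5 :=
  fun i j => ((i.+1, j.+1) \in s) || ((j.+1, i.+1) \in s).

(* The graph [edges_rel s] with [n] new, pairwise non-adjacent vertices, the
   [k]-th one being joined to the vertices in [N k]. *)
Definition extended_rel (s : seq (nat * nat)) (n : nat)
    (N : 'I_n -> {set 'I_5}) : rel ('I_5 + 'I_n)%type :=
  fun x y => match x, y with
  | inl i, inl j => edges_rel s i j
  | inl i, inr k => i \in N k
  | inr k, inl i => i \in N k
  | inr _, inr _ => false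
  end.

(* [opt'] is the chosen subset of the optional edges. *)
Definition in_family (req opt : seq (nat * nat)) (U : seq nat)
    (T : finType) (e : rel T) : Prop :=
  exists (opt' : seq (nat * nat)) (n : nat) (N : 'I_n -> {set 'I_5}),
    [/\ {subset opt' <= opt},
        forall k, N k != set0,
        forall k i, i \in N k -> i.+1 \in U
      & graph_iso e (extended_rel (req ++ opt') N)].

Definition in_G1 : forall T : finType, rel T -> Prop :=
  in_family [:: (1, 2); (2, 3); (3, 4); (4, 5)]
            [:: (1, 4); (2, 5)]
            [:: 2; 4].

Definition in_G2 : forall T : finType, rel T -> Prop :=
  in_family [:: (1, 2); (2, 3); (1, 3); (3, 4); (4, 5)]
            [:: (1, 4); (2, 4)]
            [:: 4].

Definition in_G3 : forall T : finType, rel T -> Prop :=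
  in_family [:: (1, 2); (2, 3); (3, 4); (4, 5); (5, 1)]
            [:: (1, 3); (3, 5); (2, 5); (2, 4); (1, 4)]
            [::].

Definition bowtie : rel 'I_5 :=
  edges_rel [:: (1, 2); (2, 3); (1, 3); (3, 4); (4, 5); (3, 5)].

(* Main.v *)
(** Every family contains the path 1-2-3-4-5.  Conversely, if M(G) is a connected
    graph then G contains a path x1-x2-x3-x4-x5: the middle edge of a path on 4
    vertices is disjoint from another edge, which prolongs the path since there
    is no matching of size 3, except when G is a 4-cycle with chords, whose
    matching complex is disconnected.  A vertex off the path x1-...-x5 is only
    adjacent to x2 and x4, again because there is no matching of size 3, and it
    remains to examine the chords of the path.  For the families themselves, the
    bound on matchings comes from a fractional vertex cover of weight at most
    5/2. *)

Require Import Defs.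
From mathcomp Require Import all_boot.

Set Implicit Arguments.
Unset Strict Implicit.
Unset Printing Implicit Defensive.

(** * Matchings of size two and three, and what connectedness of the complex forces *)

Section Matchings.

Variables (T : finType) (e : rel T).
Hypotheses (e_sym : symmetric e) (e_irr : irreflexive e).

Local Notation MC := (matching_complex e).

Lemma disjoint_set2 (a b c d : T) :
  [disjoint [set a; b] & [set c; d]] = [&& a != c, a != d, b != c & b != d].
Proof.
rewrite (@eq_disjoint _ _ (mem [:: a; b])) => [|x]; last by rewrite !inE.
by rewrite disjoint_has /= orbF !inE !negb_or -andbA.
Qed.

Lemma edge_setP (A : {set T}) :
  reflect (exists a b, e a b /\ A = [set a; b]) (A \in edge_set e).
Proof.
apply: (iffP imsetP) => [[[a b]]|[a [b [eab ->]]]].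
  by rewrite inE => eab ->; exists a, b.
by exists (a, b); rewrite ?inE.
Qed.

Lemma mem_edge_set a b : e a b -> [set a; b] \in edge_set e.
Proof. by move=> eab; apply/edge_setP; exists a, b. Qed.

Lemma set0_edge_set : set0 \notin edge_set e.
Proof.
by apply/edge_setP=> -[a [b [_ /setP/(_ a)]]]; rewrite !inE eqxx.
Qed.

Lemma matching_edge_disjoint (A B : {set T}) :
  ([set A; B] \in MC) =
  [&& A \in edge_set e, B \in edge_set e & (A == B) || [disjoint A & B]].
Proof.
rewrite inE /is_matching subUset !sub1set -andbA.
have [EA|] //= := boolP (A \in edge_set e).
have [EB|] //= := boolP (B \in edge_set e).
have [->|neqAB] /= := eqVneq A B; first by rewrite setUid trivIset1.
apply/trivIsetP/idP=> [|dAB C D]; first by apply; rewrite ?inE ?eqxx ?orbT.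
by rewrite !inE => /orP[]/eqP-> /orP[]/eqP->; rewrite ?eqxx // disjoint_sym.
Qed.

Lemma no_3matching a b c d f g : complex_dim_le MC 1 ->
  e a b -> e c d -> e f g -> ~~ uniq [:: a; b; c; d; f; g].
Proof.
move=> dim1 eab ecd efg; apply/negP=> U.
have Ecd := mem_edge_set ecd; have Efg := mem_edge_set efg.
have Eab := mem_edge_set eab.
have [d1 d2 d3] : [/\ [disjoint [set a; b] & [set c; d]],
   [disjoint [set a; b] & [set f; g]] & [disjoint [set c; d] & [set f; g]]].
  move: U; rewrite !disjoint_set2 /= !inE !negb_or -!andbA.
  by do ![case/andP=> ?] => _; split; apply/and4P.
(* Since the empty set is not an edge, disjointness from the other edges also shows that the added
   edge is not among them, as the count to 3 requires. *)
have [t1 n1] : trivIset [set [set c; d]; [set f; g]] /\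
    [set c; d] \notin [set [set f; g]].
  apply: trivIsetU1; rewrite ?trivIset1 ?inE //; first by move=> B /set1P->.
  by apply: contraNneq set0_edge_set => ->.
have [t2 n2] : trivIset ([set a; b] |: [set [set c; d]; [set f; g]]) /\
    [set a; b] \notin [set [set c; d]; [set f; g]].
  apply: trivIsetU1 => //; first by move=> B /set2P[]->.
  by apply: contraNN set0_edge_set => /set2P[]->.
have /dim1 : [set a; b] |: [set [set c; d]; [set f; g]] \in MC.
  by rewrite inE /is_matching t2 !subUset !sub1set Eab Ecd Efg.
by rewrite cardsU1 n2 cards2 -in_set1 n1.
Qed.

(** A second edge exists, and a walk in the 1-skeleton from [[set a; b]] to it must leave
    [[set a; b]]; the first other edge reached is disjoint from it. *)
Lemma edge_disjoint_edge a b : complex_connected MC -> 2 <= #|edge_set e| ->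
  e a b -> exists c d, [/\ e c d, a != c, a != d, b != c & b != d].
Proof.
move=> conn gt1 eab; have Eab := mem_edge_set eab.
have [B] : exists B, B \in edge_set e :\ [set a; b].
  by apply/card_gt0P; move: gt1; rewrite (cardsD1 [set a; b]) Eab.
rewrite !inE => /andP[nB EB].
have /connectP[[|C p]/=] : connect [rel A B | [set A; B] \in MC] [set a; b] B.
- by apply: conn; rewrite matching_complex_vertex.
- by move=> _ B_ab; rewrite B_ab eqxx in nB.
(* The relation also holds between an edge and itself, so the walk may linger at [[set a; b]]; the
   induction skips these loops. *)
elim: p C => [|D p IHp] C.
  rewrite /= andbT => + BC; rewrite -BC matching_edge_disjoint.
  rewrite eq_sym (negPf nB) => /and3P[_ /edge_setP[c [d [ecd ->]]]].
  by rewrite disjoint_set2 => /and4P[]; exists c, d.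
have [->|nC] := eqVneq C [set a; b].
  by case/andP=> _; apply: IHp.
rewrite /= matching_edge_disjoint eq_sym (negPf nC) /=.
case/andP=> /and3P[_ /edge_setP[c [d [ecd ->]]]].
by rewrite disjoint_set2 => /and4P[]; exists c, d.
Qed.

(* On the vertices a, b, c, d alone, {ab, cd} would be a component of M(G). *)
Lemma cycle4_outside_vertex a b c d : complex_connected MC -> uniq [:: a; b; c; d] ->
  e a b -> e b c -> e c d -> e d a -> exists y, y \notin [:: a; b; c; d].
Proof.
move=> conn U eab ebc ecd eda; apply/existsP; apply: contraT.
rewrite negb_exists => /forallP noy.
have [nac nbc nbd] : [/\ a != c, b != c & b != d].
  by move: U; rewrite /= !inE !negb_or -!andbA; do ![case/andP=> ?].
have allT y : y \in [:: a; b; c; d] by have := noy y; rewrite negbK.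
pose P := [pred A : {set T} | (A == [set a; b]) || (A == [set c; d])].
have clP : closed [rel A B | [set A; B] \in MC] P.
  apply: intro_closed => [|A B] /=.
    by apply: sym_connect_sym => A B; rewrite /= setUC.
  rewrite matching_edge_disjoint => /and3P[_ /edge_setP[x [y [exy ->]]]].
  have nxy : x != y by apply: contraTneq exy => ->; rewrite e_irr.
  case/predU1P=> [-> //|+ /orP[]/eqP defA]; rewrite defA disjoint_set2.
    move=> dis; suff -> : [set x; y] = [set c; d] by rewrite !inE eqxx orbT.
    move: (allT x) (allT y) dis nxy; rewrite !inE.
    by do 2![case/or4P=> /eqP->]; rewrite ?eqxx ?andbF // setUC.
  move=> dis; suff -> : [set x; y] = [set a; b] by rewrite !inE eqxx.
  move: (allT x) (allT y) dis nxy; rewrite !inE.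
  by do 2![case/or4P=> /eqP->]; rewrite ?eqxx ?andbF // setUC.
(* The edge [bc] is reachable from [ab], yet it is neither [ab] nor [cd]. *)
have /(closed_connect clP) :
    connect [rel A B | [set A; B] \in MC] [set a; b] [set b; c].
  by apply: conn; rewrite matching_complex_vertex mem_edge_set.
rewrite !inE eqxx => /esym/orP[]/eqP/setP.
  by move/(_ c); rewrite !inE eqxx orbT ![c == _]eq_sym (negPf nac) (negPf nbc).
by move/(_ b); rewrite !inE eqxx (negPf nbc) (negPf nbd).
Qed.

End Matchings.

(** * Families described by an embedded copy of the five base vertices *)

Section Families.

Variables (T : finType) (e : rel T).
Hypotheses (e_sym : symmetric e) (e_irr : irreflexive e).

(** The new vertices are those off the image of [v], and the optional edges in use are read off [e],
    so that [v] is the only choice left. *)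
Definition embedded_family (req opt : seq (nat * nat)) (U : seq nat)
    (v : 'I_5 -> T) : Prop :=
  [/\ injective v,
      forall i j, edges_rel req i j -> e (v i) (v j),
      forall i j, e (v i) (v j) -> edges_rel (req ++ opt) i j
    & forall y z, y \notin codom v -> e y z ->
        exists2 i, z = v i & i.+1 \in U].

Lemma edges_rel_cat s t i j :
  edges_rel (s ++ t) i j = edges_rel s i j || edges_rel t i j.
Proof. by rewrite /edges_rel !mem_cat orbACA. Qed.

Lemma edges_relS s t i j :
  {subset s <= t} -> edges_rel s i j -> edges_rel t i j.
Proof. by move=> st /orP[] /st st'; rewrite /edges_rel st' ?orbT. Qed.

Lemma in_family_embedded req opt U :
  in_family req opt U e -> exists v, embedded_family req opt U v.
Proof.
case=> opt' [n [N [sub _ NU [f [g fK gK] isof]]]].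
have isog x y : e (g x) (g y) = extended_rel (req ++ opt') N x y.
  by rewrite -isof !gK.
exists (g \o inl); split=> [|i j|i j|y z].
- by apply: inj_comp (can_inj gK) _ => i j [].
- by rewrite /= isog /= edges_rel_cat => ->.
- rewrite /= isog; apply: edges_relS => p; rewrite !mem_cat.
  by case/orP=> [->|/sub->]; rewrite ?orbT.
rewrite -[y]fK -[z]fK isog; case: (f y) => [i|k] /=.
  by case/codomP; exists i.
by case: (f z) => [i|k'] // _ /NU; exists i.
Qed.

Lemma embedded_in_family req opt U v : graph_connected e ->
  embedded_family req opt U v -> in_family req opt U e.
Proof.
move=> conn [v_inj v_req v_opt v_out].
pose opt' := [seq p <- opt | [exists i, exists j,
  (((nat_of_ord i).+1, (nat_of_ord j).+1) == p) && e (v i) (v j)]].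
pose A := [set y | y \notin codom v].
pose N (k : 'I_#|A|) := [set i | e (v i) (enum_val k)].
pose g (x : 'I_5 + 'I_#|A|) :=
  match x with inl i => v i | inr k => enum_val k end.
have outP (k : 'I_#|A|) : enum_val k \notin codom v.
  by have := enum_valP k; rewrite inE.
have g_bij : bijective g.
  apply: inj_card_bij => [[i|k] [j|l] /= eq_g|].
  - by rewrite (v_inj _ _ eq_g).
  - by case/negP: (outP l); rewrite -eq_g codom_f.
  - by case/negP: (outP k); rewrite eq_g codom_f.
  - by rewrite (enum_val_inj eq_g).
  rewrite card_sum card_ord card_ord -(cardC (mem (codom v))).
  by rewrite (card_codom v_inj) card_ord cardsE.
exists opt', #|A|, N; split.
- by move=> p; rewrite mem_filter => /andP[].
(* The walk from a new vertex to [v ord0] begins with an edge, which must end in the image of [v];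
   hence the neighbourhood is nonempty. *)
- move=> k; have /connectP[[|z p] /=] := conn (enum_val k) (v ord0).
    by move=> _ eq_k; case/negP: (outP k); rewrite -eq_k codom_f.
  case/andP=> ekz _ _; have [i z_i _] := v_out _ _ (outP k) ekz.
  by apply/set0Pn; exists i; rewrite inE e_sym -z_i.
- move=> k i; rewrite inE e_sym => /(v_out _ _ (outP k))[j /v_inj->] //.
case: (g_bij) => f gK fK; exists f; first by exists g.
suff isog x y : extended_rel (req ++ opt') N x y = e (g x) (g y).
  by move=> x y; rewrite isog !fK.
case: x y => [i|k] [j|l] /=; rewrite ?inE //; last 1 first.
- by apply/esym/negP => /(v_out _ _ (outP k))[i ei _]; case/negP: (outP l);
    rewrite ei codom_f.
- rewrite edges_rel_cat; apply/orP/idP => [[/v_req //|]|eij].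
    rewrite /edges_rel !mem_filter.
    case/orP=> /andP[/existsP[i' /existsP[j']]];
      by case/andP=> /eqP[/val_inj<- /val_inj<-] //; rewrite e_sym.
  have := v_opt _ _ eij; rewrite edges_rel_cat.
  case/orP=> [|opt_ij]; [by left | right]; move: opt_ij.
  rewrite /edges_rel !mem_filter => /orP[]->; rewrite andbT; apply/orP.
    by left; apply/existsP; exists i; apply/existsP; exists j; rewrite eqxx.
  right; apply/existsP; exists j; apply/existsP; exists i.
  by rewrite eqxx e_sym.
Qed.

(** With [U] empty, a vertex off the image of [v] has no neighbour, so connectedness makes [v]
    surjective. A single graph can thus be treated as a family. *)
Lemma graph_iso_embedded s : graph_connected e ->
  graph_iso e (edges_rel s) <-> exists v, embedded_family s [::] [::] v.
Proof.
move=> conn; split.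
  case=> f [g fK gK] isof; exists g; split=> [|i j|i j|y z].
  - exact: can_inj gK.
  - by rewrite -isof !gK.
  - by rewrite cats0 -isof !gK.
  - by rewrite -[y]fK codom_f.
case=> v [v_inj v_req v_opt v_out].
have v_surj y : y \in codom v.
  apply: contraT => y_out; have /connectP[[|z p] /=] := conn y (v ord0).
    by move=> _ eq_y; case/negP: y_out; rewrite -eq_y codom_f.
  by case/andP=> /(v_out _ _ y_out)[].
have [|f vK fK] := @inj_card_bij _ _ v v_inj.
  by rewrite -(card_codom v_inj); apply/subset_leq_card/subsetP.
exists f; first by exists v.
move=> x y; rewrite -{2}[x]fK -{2}[y]fK; apply/idP/idP => [/v_req //|/v_opt].
by rewrite cats0.
Qed.

(* The weights [w] are twice a fractional vertex cover, so a cover of total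
   weight at most 5/2 excludes matchings of size 3.  The new vertices get
   weight 0.  Entry 0 of [w] is a dummy, as vertices are numbered from 1. *)
Lemma embedded_dim_le1 req opt U v (w : seq nat) :
    embedded_family req opt U v ->
    all (fun p => 2 <= nth 0 w p.1 + nth 0 w p.2) (req ++ opt) ->
    all (fun u => 2 <= nth 0 w u) U ->
    \sum_(i < 5) nth 0 w i.+1 <= 5 ->
  complex_dim_le (matching_complex e) 1.
Proof.
move=> [v_inj v_req v_opt v_out] /allP w_edge /allP w_U w_sum M.
rewrite inE => /andP[/subsetP ME trM].
pose W x := \sum_(i < 5 | v i == x) nth 0 w i.+1.
have WE i : W (v i) = nth 0 w i.+1.
  rewrite /W (bigD1 i) //= big1 ?addn0 // => j /andP[/eqP/v_inj->].
  by rewrite eqxx.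
have W_edge A : A \in M -> 2 <= \sum_(x in A) W x.
  move=> /ME/edge_setP[x [y [exy ->]]].
  have nxy : x != y by apply: contraTneq exy => ->; rewrite e_irr.
  rewrite big_setU1 ?inE //= big_set1.
  have [/codomP[i xE]|x_out] := boolP (x \in codom v); last first.
    have [i -> /w_U] := v_out _ _ x_out exy; rewrite WE.
    by move=> le2; apply: leq_trans le2 (leq_addl _ _).
  have [/codomP[j yE]|y_out] := boolP (y \in codom v); last first.
    move: exy; rewrite e_sym => /(v_out _ _ y_out)[k -> /w_U]; rewrite WE.
    by move=> le2; apply: leq_trans le2 (leq_addr _ _).
  move: exy; rewrite xE yE => /v_opt; rewrite !WE.
  by case/orP=> /w_edge //=; rewrite addnC.
(* The edges of [M] are disjoint and each has weight at least 2, so [#|M| * 2] is at most the total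
   weight. *)
have: #|M| * 2 <= 5.
  apply: leq_trans w_sum; rewrite (partition_big v predT) //=.
  rewrite -sum_nat_const; apply: (@leq_trans (\sum_(A in M) \sum_(x in A) W x)).
    exact: leq_sum.
  rewrite -big_trivIset //=.
  by rewrite [leqRHS](bigID (mem (cover M))) /= leq_addr.
by case: #|M| => [|[|[|m]]].
Qed.

Definition disjoint_pairs (p q : nat * nat) :=
  [&& p.1 != q.1, p.1 != q.2, p.2 != q.1 & p.2 != q.2].

(* [q :: s] is a walk in the matching complex through required edges, such that
   every edge of the graph is disjoint from some edge of the walk. *)
Lemma embedded_connected req opt U v q s :
    embedded_family req opt U v ->
    all (fun p => (0 < p.1 <= 5) && (0 < p.2 <= 5)) (q :: s) ->
    {subset q :: s <= req} -> path disjoint_pairs q s ->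
    all (fun p => has (disjoint_pairs p) (q :: s)) (req ++ opt) ->
    all (fun u => has (fun p => (u != p.1) && (u != p.2)) (q :: s)) U ->
  complex_connected (matching_complex e).
Proof.
move=> [v_inj v_req v_opt v_out] s_le5 s_req s_path /allP s_edge /allP s_U.
pose R := [rel A B | [set A; B] \in matching_complex e].
have R_sym : connect_sym R by apply: sym_connect_sym => A B; rewrite /= setUC.
(* Labels start at 1 and ordinals at 0, hence the predecessors. *)
pose E (p : nat * nat) := [set v (inord p.1.-1); v (inord p.2.-1)].
have inordE a (lta : a < 5) : inord a = Ordinal lta :> 'I_5.
  by apply/val_inj; rewrite /= inordK.
have sP p : p \in q :: s -> exists i j : 'I_5,
    [/\ p = (i.+1, j.+1), E p = [set v i; v j] & e (v i) (v j)].
  case: p => a b ps; have /andP[] := allP s_le5 _ ps.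
  case: a ps => //= a; case: b => //= b ps lta ltb.
  have e_ab : edges_rel req (Ordinal lta) (Ordinal ltb).
    by rewrite /edges_rel /= s_req.
  exists (Ordinal lta), (Ordinal ltb); split; [by []| |exact: v_req].
  by rewrite /E /= !(inordE _ lta, inordE _ ltb).
have R_disjoint x y (i j : 'I_5) p :
    e x y -> p \in q :: s -> p = (i.+1, j.+1) ->
    [&& x != v i, x != v j, y != v i & y != v j] -> R (E p) [set x; y].
  move=> exy /sP[i' [j' [-> -> eij]]] [/val_inj ii' /val_inj jj'] nxy.
  rewrite ii' jj' in eij *.
  rewrite /R /= setUC matching_edge_disjoint disjoint_set2 nxy orbT andbT.
  by rewrite !mem_edge_set.
have neq_v (i j : 'I_5) : (v i != v j) = (i.+1 != j.+1).
  by rewrite (inj_eq v_inj) eqSS.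
have walk p : p \in q :: s -> connect R (E q) (E p).
  have R_path : path R (E q) (map E s).
    rewrite path_map; apply: (sub_in_path (P := mem (q :: s))) s_path;
      last exact/allP.
    move=> p1 p2 ps1 ps2 dis /=; have [i [j [p2E -> eij]]] := sP _ ps2.
    have [k [l [p1E _ _]]] := sP _ ps1; apply: (R_disjoint _ _ k l) => //.
    rewrite !neq_v ![_ == k.+1]eq_sym ![_ == l.+1]eq_sym.
    by move: dis; rewrite p1E p2E => /and4P[/= -> -> -> ->].
  by move=> ps; apply: (path_connect R_path); apply: (map_f E ps).
have q_conn p A : p \in q :: s -> R (E p) A -> connect R (E q) A.
  by move=> /walk qp RpA; apply: connect_trans qp (@connect1 _ R _ _ RpA).
(* The end [x] differs from every [v j], so an edge of the walk only has to avoid the other end,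
   whose label lies in [U]. *)
have q_out x y : e x y -> x \notin codom v -> connect R (E q) [set x; y].
  move=> exy x_out; have [i y_i /s_U/hasP[p ps /andP[]]] := v_out _ _ x_out exy.
  have [k [l [pE _ _]]] := sP p ps; rewrite pE => nik nil.
  have n_out j : x != v j by apply: contraNneq x_out => ->; apply: codom_f.
  apply: (q_conn p) => //; apply: (R_disjoint _ _ k l) => //.
  by rewrite !n_out y_i !neq_v nik.
have q_in (i j : 'I_5) : e (v i) (v j) -> (i.+1, j.+1) \in req ++ opt ->
    connect R (E q) [set v i; v j].
  move=> eij /s_edge/hasP[p ps]; have [k [l [pE _ _]]] := sP p ps.
  move=> dis; apply: (q_conn p) => //; apply: (R_disjoint _ _ k l) => //.
  by rewrite !neq_v; rewrite pE in dis.
suff to_q A : A \in edge_set e -> connect R (E q) A.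
  move=> A B; rewrite !matching_complex_vertex => /to_q EA /to_q EB.
  by apply: connect_trans EB; rewrite R_sym.
case/edge_setP=> x [y [exy ->]].
have [/codomP[i xE]|/q_out->//] := boolP (x \in codom v).
have [/codomP[j yE]|y_out] := boolP (y \in codom v); last first.
  by rewrite setUC q_out // e_sym.
move: exy; rewrite {}xE {}yE => eij; have /orP[] := v_opt _ _ eij.
  exact: q_in.
by rewrite setUC; apply: q_in; rewrite e_sym.
Qed.

End Families.

(** Distinctness is handled through pairwise inequalities: [split_uniq] unpacks a [uniq] hypothesis
    into the context, and [neq_tac] proves such goals from the context up to symmetry. *)
Ltac split_uniq H :=
  move: H; rewrite /= ?inE ?negb_or -?andbA; do ![case/andP=> ?]; move=> _.
Ltac neq_tac :=
  rewrite /= ?inE ?negb_or -?andbA; repeat (apply/andP; split);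
  solve [by [] | by rewrite eq_sym].

(** * Existence of paths on four and five vertices *)

Section Paths.

Variables (T : finType) (e : rel T).
Hypotheses (e_sym : symmetric e) (e_irr : irreflexive e).
Hypotheses (e_conn : graph_connected e) (e_edges : 2 <= #|edge_set e|).
Hypotheses (dim1 : complex_dim_le (matching_complex e) 1)
           (conn1 : complex_connected (matching_complex e)).

Lemma edge_neq x y : e x y -> x != y.
Proof. by apply: contraTneq => ->; rewrite e_irr. Qed.

(** Otherwise [A] would be closed under adjacency and, by connectedness, contain [y]. *)
Lemma leaving_edge (A : {pred T}) x y : x \in A -> y \notin A ->
  exists u t, [/\ u \in A, t \notin A & e u t].
Proof.
move=> Ax Ay.
have: [exists p, [&& p.1 \in A, p.2 \notin A & e p.1 p.2]].
  apply: contraT; rewrite negb_exists => /forallP no.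
  have clA : closed e A.
    apply: intro_closed => [|u t eut Au]; first exact: sym_connect_sym.
    by have := no (u, t); rewrite /= Au eut andbT negbK.
  by rewrite -(closed_connect clA (e_conn x y)) Ax in Ay.
by case/existsP=> -[u t] /and3P[]; exists u, t.
Qed.

Definition path4 a b c d := [&& uniq [:: a; b; c; d], e a b, e b c & e c d].

Definition path5 a b c d f :=
  [&& uniq [:: a; b; c; d; f], e a b, e b c, e c d & e d f].

(** An edge leaving the closed neighbourhood of an edge [xy] joins a neighbour of [x] or [y] to a
    vertex adjacent to neither, and so prolongs [xy] to a path. *)
Lemma path4_exists : exists a b c d, path4 a b c d.
Proof.
have: [exists p : T * T * T * T, path4 p.1.1.1 p.1.1.2 p.1.2 p.2].
  apply: contraT; rewrite negb_exists => /forallP no.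
  have {no} no a b c d : ~~ path4 a b c d by apply: (no (a, b, c, d)).
  have [E0] : exists A, A \in edge_set e.
    by apply/card_gt0P; apply: leq_trans e_edges.
  case/edge_setP=> x [y [exy _]]; have nxy := edge_neq exy.
  have [z [w [ezw nxz nxw nyz nyw]]] := edge_disjoint_edge conn1 e_edges exy.
  (* The vertex [z] is outside: were it adjacent to [x] or [y], then [w], [z] and the edge [xy]
     would already form a path. *)
  have [] := @leaving_edge [pred u | [|| u == x, u == y, e u x | e u y]] x z.
  - by rewrite inE eqxx.
  - rewrite inE ![z == _]eq_sym (negPf nxz) (negPf nyz) /=.
    have nzw := edge_neq ezw.
    apply/negP=> /orP[ezx|ezy].
      case/negP: (no w z x y); rewrite /path4 [e w z]e_sym ezw ezx exy !andbT.
      by neq_tac.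
    case/negP: (no w z y x); rewrite /path4 [e w z]e_sym ezw ezy [e y x]e_sym.
    by rewrite exy !andbT; neq_tac.
  move=> u [t []]; rewrite !inE !negb_or.
  move=> Su /and4P[ntx nty nNx nNy] eut; have nut := edge_neq eut.
  rewrite ![e t _]e_sym in nNx nNy.
  case/or4P: Su => [/eqP ux|/eqP uy|eux|euy].
  - by rewrite -ux eut in nNx.
  - by rewrite -uy eut in nNy.
  - have nux := edge_neq eux.
    have nuy : u != y by apply: contraNneq nNy => <-.
    case/negP: (no t u x y); rewrite /path4 [e t u]e_sym eut eux exy !andbT.
    by neq_tac.
  - have nuy := edge_neq euy.
    have nux : u != x by apply: contraNneq nNx => <-.
    case/negP: (no t u y x); rewrite /path4 [e t u]e_sym eut euy [e y x]e_sym.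
    by rewrite exy !andbT; neq_tac.
by case/existsP=> -[[[a b] c] d]; exists a, b, c, d.
Qed.

(** Some vertex lies off the 4-cycle, so an edge enters the cycle from outside; following it and
    then going around the cycle gives the path. *)
Lemma cycle4_path5 a b c d : path4 a b c d -> e d a ->
  exists x1 x2 x3 x4 x5, path5 x1 x2 x3 x4 x5.
Proof.
case/and4P=> U eab ebc ecd eda.
have [y y_out] := cycle4_outside_vertex e_irr conn1 U eab ebc ecd eda.
have [|u [t [uC tC eut]]] := @leaving_edge (mem [:: a; b; c; d]) a y _ y_out.
  by rewrite inE eqxx.
move: tC uC eut; rewrite e_sym !inE !negb_or => /and4P[nta ntb ntc ntd].
split_uniq U.
case/or4P=> /eqP-> etu.
- by exists t, a, b, c, d; rewrite /path5 etu eab ebc ecd !andbT; neq_tac.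
- by exists t, b, c, d, a; rewrite /path5 etu eda ebc ecd !andbT; neq_tac.
- by exists t, c, d, a, b; rewrite /path5 etu eda eab ecd !andbT; neq_tac.
- by exists t, d, a, b, c; rewrite /path5 etu eda eab ebc !andbT; neq_tac.
Qed.

(* An edge disjoint from the middle edge of a path on 4 vertices either prolongs
   the path, closes it to a 4-cycle, or completes a matching of size 3. *)
Lemma path5_exists : exists x1 x2 x3 x4 x5, path5 x1 x2 x3 x4 x5.
Proof.
have [a [b [c [d P4]]]] := path4_exists; have /and4P[U eab ebc ecd] := P4.
have [p [q [epq nbp nbq ncp ncq]]] := edge_disjoint_edge conn1 e_edges ebc.
have npq := edge_neq epq.
(* Stated for arbitrary ends because either [p] or [q] may be [a]; the other end is [d], closing a
   4-cycle, or off the path. *)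
have extend x y : e x y -> b != x -> b != y -> c != x -> c != y -> x = a ->
    exists x1 x2 x3 x4 x5, path5 x1 x2 x3 x4 x5.
  move=> exy nbx nby ncx ncy xa; have nxy := edge_neq exy.
  rewrite {}xa in exy nxy *.
  have [yd|nyd] := eqVneq y d.
    by apply: (cycle4_path5 P4); rewrite e_sym -yd.
  exists y, a, b, c, d; rewrite /path5 [e y a]e_sym exy eab ebc ecd !andbT.
  by split_uniq U; neq_tac.
have extend' x y : e x y -> b != x -> b != y -> c != x -> c != y -> x = d ->
    exists x1 x2 x3 x4 x5, path5 x1 x2 x3 x4 x5.
  move=> exy nbx nby ncx ncy xd; have nxy := edge_neq exy.
  rewrite {}xd in exy nxy *.
  have [ya|nya] := eqVneq y a.
    by apply: (cycle4_path5 P4); rewrite -ya.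
  exists a, b, c, d, y; rewrite /path5 exy eab ebc ecd !andbT.
  by split_uniq U; neq_tac.
have [pa|npa] := eqVneq p a; first exact: (extend p q).
have [pd|npd] := eqVneq p d; first exact: (extend' p q).
have eqp : e q p by rewrite e_sym.
have [qa|nqa] := eqVneq q a; first exact: (extend q p).
have [qd|nqd] := eqVneq q d; first exact: (extend' q p).
case/negP: (no_3matching dim1 epq eab ecd).
by split_uniq U; neq_tac.
Qed.

(** The entry at index 0 is a dummy, so that labels start at 1. *)
Definition vertex_nth x1 x2 x3 x4 x5 : nat -> T :=
  nth x1 [:: x1; x1; x2; x3; x4; x5].

(** The conditions are bounded boolean checks, which simplify away on concrete lists; the second one
    runs over the ten pairs [i < j], symmetry of [e] giving the others. *)
Lemma embedded_familyI req opt U x1 x2 x3 x4 x5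
    (X := vertex_nth x1 x2 x3 x4 x5) (L := req ++ opt) :
    uniq [:: x1; x2; x3; x4; x5] ->
    all (fun p => e (X p.1) (X p.2)) req ->
    all (fun i => all (fun j => e (X i) (X j) ==>
      ((i, j) \in L) || ((j, i) \in L)) (iota i.+1 (5 - i))) (iota 1 5) ->
    all (fun u => 0 < u <= 5) U ->
    (forall y z, y \notin [:: x1; x2; x3; x4; x5] -> e y z ->
      has (fun u => z == X u) U) ->
  exists v, embedded_family e req opt U v.
Proof.
move=> uX /allP X_req /allP X_opt /allP U_le5 X_out.
have v_lt i j : i < j -> j < 5 -> e (X i.+1) (X j.+1) ->
    ((i.+1, j.+1) \in L) || ((j.+1, i.+1) \in L).
  move=> ltij ltj; have /X_opt/allP/(_ j.+1) : i.+1 \in iota 1 5.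
    by rewrite mem_iota /= ltnS (ltn_trans ltij).
  rewrite mem_iota addSn subnKC ?(ltn_trans ltij) // 2!ltnS ltij ltj.
  by move=> /(_ isT)/implyP.
exists (fun i : 'I_5 => X i.+1); split=> [i j|i j|i j|y z].
- have XE (k : 'I_5) : X k.+1 = nth x1 [:: x1; x2; x3; x4; x5] k by [].
  by rewrite !XE => /eqP; rewrite nth_uniq // => /eqP/val_inj.
- by case/orP=> /X_req //=; rewrite e_sym.
- rewrite /edges_rel -/L; case: (ltngtP i j) => [ltij|ltji|/val_inj->].
  + exact: v_lt.
  + by rewrite e_sym orbC; apply: v_lt.
  + by rewrite e_irr.
move=> y_out eyz; have: y \notin [:: x1; x2; x3; x4; x5].
  apply: contra y_out => /(nthP x1)[k lt_k <-].
  by apply/codomP; exists (Ordinal lt_k).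
move/X_out/(_ eyz)/hasP => [[|u] Uu /eqP->]; first by have := U_le5 _ Uu.
have /= lt_u := U_le5 _ Uu.
by exists (Ordinal lt_u).
Qed.

(** * Vertices off the path and chords of the path *)

Lemma path5_rev x1 x2 x3 x4 x5 :
  path5 x1 x2 x3 x4 x5 -> path5 x5 x4 x3 x2 x1.
Proof.
case/and5P=> U *; apply/and5P; split; rewrite 1?e_sym //.
by rewrite -[[:: x5; _; _; _; _]]/(rev [:: x1; x2; x3; x4; x5]) rev_uniq.
Qed.

(** If [z] is [x1], [x3], [x5] or off the path, two disjoint edges of the path avoid [z] and form
    with [yz] a matching of size 3. *)
Lemma outside_path5 x1 x2 x3 x4 x5 y z : path5 x1 x2 x3 x4 x5 ->
  y \notin [:: x1; x2; x3; x4; x5] -> e y z -> (z == x2) || (z == x4).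
Proof.
case/and5P=> U e12 e23 e34 e45 y_out eyz; have nyz := edge_neq eyz.
split_uniq U; move: y_out; rewrite !inE !negb_or => /and5P[*].
apply: contraT; rewrite negb_or => /andP[nz2 nz4].
have [z1|nz1] := eqVneq z x1.
  by case/negP: (no_3matching dim1 eyz e23 e45); rewrite z1; neq_tac.
have [z3|nz3] := eqVneq z x3.
  by case/negP: (no_3matching dim1 eyz e12 e45); rewrite z3; neq_tac.
have [z5|nz5] := eqVneq z x5.
  by case/negP: (no_3matching dim1 eyz e12 e34); rewrite z5; neq_tac.
by case/negP: (no_3matching dim1 eyz e12 e34); neq_tac.
Qed.

(* [x2 x4] must be disjoint from some edge, and edges leaving the path end in
   [x2] or [x4]. *)
Lemma path5_edge24 x1 x2 x3 x4 x5 : path5 x1 x2 x3 x4 x5 ->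
  e x2 x4 -> [|| e x1 x3, e x1 x5 | e x3 x5].
Proof.
move=> P5 e24.
have [c [d [ecd n2c n2d n4c n4d]]] := edge_disjoint_edge conn1 e_edges e24.
have in_path u t : e u t -> x2 != t -> x4 != t -> u \in [:: x1; x2; x3; x4; x5].
  move=> eut n2t n4t; apply: contraT => /(outside_path5 P5)/(_ eut).
  by rewrite ![t == _]eq_sym (negPf n2t) (negPf n4t).
have := in_path c d ecd n2d n4d; have: d \in [:: x1; x2; x3; x4; x5].
  by apply: (in_path d c); rewrite // e_sym.
rewrite !inE ![_ == x2]eq_sym ![_ == x4]eq_sym.
rewrite (negPf n2c) (negPf n2d) (negPf n4c) (negPf n4d) /=.
case/or3P=> /eqP dE; case/or3P=> /eqP cE; move: ecd; rewrite dE cE ?e_irr //;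
  by [move=> ->; rewrite ?orbT | rewrite e_sym => ->; rewrite ?orbT].
Qed.

Lemma in_familyI req opt U x1 x2 x3 x4 x5
    (X := vertex_nth x1 x2 x3 x4 x5) (L := req ++ opt) :
    uniq [:: x1; x2; x3; x4; x5] ->
    all (fun p => e (X p.1) (X p.2)) req ->
    all (fun i => all (fun j => e (X i) (X j) ==>
      ((i, j) \in L) || ((j, i) \in L)) (iota i.+1 (5 - i))) (iota 1 5) ->
    all (fun u => 0 < u <= 5) U ->
    (forall y z, y \notin [:: x1; x2; x3; x4; x5] -> e y z ->
      has (fun u => z == X u) U) ->
  in_family req opt U e.
Proof.
move=> uX X_req X_opt U_le5 X_out.
have [v v_emb] := embedded_familyI uX X_req X_opt U_le5 X_out.
exact: embedded_in_family v_emb.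
Qed.

(** The required and optional edges together are all ten pairs, so a spanning 5-cycle suffices. *)
Lemma cycle5_in_G3 x1 x2 x3 x4 x5 : path5 x1 x2 x3 x4 x5 -> e x5 x1 ->
  (forall y, y \in [:: x1; x2; x3; x4; x5]) -> in_G3 e.
Proof.
case/and5P=> U e12 e23 e34 e45 e51 allX.
apply: (in_familyI U) => //=; first by rewrite e12 e23 e34 e45 e51.
  by rewrite !implybT.
by move=> y z; rewrite allX.
Qed.

(** The chord [x2 x4] would need one of the three absent chords; the two remaining chords are
    optional. *)
Lemma path5_in_G1 x1 x2 x3 x4 x5 : path5 x1 x2 x3 x4 x5 ->
  ~~ e x1 x3 -> ~~ e x1 x5 -> ~~ e x3 x5 -> in_G1 e.
Proof.
move=> P5 n13 n15 n35; have n24 : ~~ e x2 x4.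
  by apply/negP=> /(path5_edge24 P5);
    rewrite !(negPf n13, negPf n15, negPf n35).
have /and5P[U e12 e23 e34 e45] := P5.
apply: (in_familyI U) => //=; first by rewrite e12 e23 e34 e45.
  by rewrite !(negPf n13, negPf n15, negPf n35, negPf n24) /= ?implybT.
by move=> y z /(outside_path5 P5)/[apply]; rewrite orbF.
Qed.

Lemma path5_in_G2 x1 x2 x3 x4 x5 : path5 x1 x2 x3 x4 x5 -> e x1 x3 ->
  ~~ e x1 x5 -> ~~ e x2 x5 -> ~~ e x3 x5 ->
  (forall y, y \notin [:: x1; x2; x3; x4; x5] -> ~~ e y x2) -> in_G2 e.
Proof.
move=> P5 e13 n15 n25 n35 n_out2; have /and5P[U e12 e23 e34 e45] := P5.
apply: (in_familyI U) => //=; first by rewrite e12 e23 e13 e34 e45.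
  by rewrite !(negPf n15, negPf n25, negPf n35) /= ?implybT.
move=> y z y_out eyz; rewrite orbF.
case/orP: (outside_path5 P5 y_out eyz) => // /eqP z2.
by rewrite z2 (negPf (n_out2 y y_out)) in eyz.
Qed.

(** Using [w x4] in a matching frees [x5], whose chords to [x1] and [x3] would then complete a
    matching of size 3. The chord [x1 x3] selects the family; when present, it likewise excludes
    [x2 x5] and outside neighbours of [x2]. *)
Lemma outside4_in_family x1 x2 x3 x4 x5 w : path5 x1 x2 x3 x4 x5 ->
  w \notin [:: x1; x2; x3; x4; x5] -> e w x4 -> in_G1 e \/ in_G2 e.
Proof.
move=> P5 w_out ew4; have /and5P[U e12 e23 e34 e45] := P5.
have n_out y : y \notin [:: x1; x2; x3; x4; x5] ->
    [&& y != x1, y != x2, y != x3, y != x4 & y != x5].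
  by rewrite !inE !negb_or.
split_uniq U; have /and5P[*] := n_out w w_out.
have n15 : ~~ e x1 x5.
  by apply/negP=> e15; case/negP: (no_3matching dim1 ew4 e15 e23); neq_tac.
have n35 : ~~ e x3 x5.
  by apply/negP=> e35; case/negP: (no_3matching dim1 ew4 e12 e35); neq_tac.
have [e13|n13] := boolP (e x1 x3); last by left; apply: path5_in_G1 P5 _ _ _.
right; apply: path5_in_G2 P5 _ _ _ _ _ => //.
  by apply/negP=> e25; case/negP: (no_3matching dim1 ew4 e25 e13); neq_tac.
move=> y /n_out/and5P[*]; apply/negP=> ey2.
by case/negP: (no_3matching dim1 ey2 e13 e45); neq_tac.
Qed.

(** The chord [x2 x5] decides: it closes the 5-cycle [x1 x3 x4 x5 x2]. *)
Lemma triangle_in_family x1 x2 x3 x4 x5 : path5 x1 x2 x3 x4 x5 ->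
  (forall y, y \in [:: x1; x2; x3; x4; x5]) ->
  e x1 x3 -> ~~ e x1 x5 -> ~~ e x3 x5 -> in_G2 e \/ in_G3 e.
Proof.
move=> P5 allX e13 n15 n35; have /and5P[U e12 e23 e34 e45] := P5.
have [e25|n25] := boolP (e x2 x5).
  right; apply: (@cycle5_in_G3 x1 x3 x4 x5 x2); last first.
  - by move=> y; have := allX y; rewrite !inE; do ![case: eqVneq => //= _].
  - by rewrite e_sym.
  rewrite /path5 e13 e34 e45 [e x5 x2]e_sym e25 !andbT.
  by split_uniq U; neq_tac.
by left; apply: path5_in_G2 P5 _ _ _ _ _ => // y; rewrite allX.
Qed.

(** Each of the three undecided chords would turn the two triangles at [x3] into a graph with a
    spanning 5-cycle. *)
Lemma bowtie_in_family x1 x2 x3 x4 x5 : path5 x1 x2 x3 x4 x5 ->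
  (forall y, y \in [:: x1; x2; x3; x4; x5]) ->
  e x1 x3 -> e x3 x5 -> ~~ e x1 x5 -> in_G3 e \/ graph_iso e bowtie.
Proof.
move=> P5 allX e13 e35 n15; have /and5P[U e12 e23 e34 e45] := P5.
have e21 : e x2 x1 by rewrite e_sym. have e54 : e x5 x4 by rewrite e_sym.
have e31 : e x3 x1 by rewrite e_sym. have e53 : e x5 x3 by rewrite e_sym.
have cyc y1 y2 y3 y4 y5 :
    perm_eq [:: x1; x2; x3; x4; x5] [:: y1; y2; y3; y4; y5] ->
    [&& e y1 y2, e y2 y3, e y3 y4, e y4 y5 & e y5 y1] -> in_G3 e.
  move=> pX /and5P[f12 f23 f34 f45 f51].
  apply: (@cycle5_in_G3 y1 y2 y3 y4 y5) => // [|y].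
    by rewrite /path5 -(perm_uniq pX) U f12 f23 f34.
  by rewrite -(perm_mem pX).
have permX (s : seq T) : size s = 5 -> {subset [:: x1; x2; x3; x4; x5] <= s} ->
    perm_eq [:: x1; x2; x3; x4; x5] s.
  move=> ss sub; have [_ eqs] := uniq_min_size U sub (eq_leq ss).
  by apply: uniq_perm => //; apply: leq_size_uniq U sub (eq_leq ss).
have [e14|n14] := boolP (e x1 x4).
  left; apply: (cyc x1 x2 x3 x5 x4).
    by apply: permX => // y; rewrite !inE; do ![case: eqVneq => //= _].
  by rewrite e12 e23 e35 e54 e_sym.
have [e25|n25] := boolP (e x2 x5).
  left; apply: (cyc x1 x3 x4 x5 x2).
    by apply: permX => // y; rewrite !inE; do ![case: eqVneq => //= _].
  by rewrite e13 e34 e45 e21 e_sym e25.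
have [e24|n24] := boolP (e x2 x4).
  left; apply: (cyc x1 x2 x4 x5 x3).
    by apply: permX => // y; rewrite !inE; do ![case: eqVneq => //= _].
  by rewrite e12 e24 e45 e53 e31.
right; apply/(graph_iso_embedded _ e_conn).
apply: (embedded_familyI U) => //=; first by rewrite e12 e23 e13 e34 e45 e35.
  by rewrite !(negPf n14, negPf n25, negPf n24, negPf n15) /= ?implybT.
by move=> y z; rewrite allX.
Qed.

Lemma connected_matching_families :
  [\/ in_G1 e, in_G2 e, in_G3 e | graph_iso e bowtie].
Proof.
have [x1 [x2 [x3 [x4 [x5 P5]]]]] := path5_exists.
have P5r := path5_rev P5; have /and5P[U e12 e23 e34 e45] := P5.
have memr y : (y \in [:: x5; x4; x3; x2; x1]) = (y \in [:: x1; x2; x3; x4; x5]).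
  by rewrite -[RHS]mem_rev.
have [|no4] := boolP [exists w, (w \notin [:: x1; x2; x3; x4; x5]) && e w x4].
  by case/existsP=> w /andP[/(outside4_in_family P5)/[apply]] []; constructor.
have [|no2] := boolP [exists w, (w \notin [:: x1; x2; x3; x4; x5]) && e w x2].
  case/existsP=> w; rewrite -memr => /andP[/(outside4_in_family P5r)/[apply]].
  by case; constructor.
have allX y : y \in [:: x1; x2; x3; x4; x5].
  apply: contraT => y_out.
  have [|u [t [uX]]] :=
    @leaving_edge (mem [:: x1; x2; x3; x4; x5]) x1 y _ y_out.
    by rewrite inE eqxx.
  rewrite e_sym => t_out etu.
  case/orP: (outside_path5 P5 t_out etu) => /eqP utE.
    by case/negP: no2; apply/existsP; exists t; rewrite t_out -utE.
  by case/negP: no4; apply/existsP; exists t; rewrite t_out -utE.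
have allXr y : y \in [:: x5; x4; x3; x2; x1] by rewrite memr.
have [e15|n15] := boolP (e x1 x5).
  by constructor 3; apply: (cycle5_in_G3 P5); rewrite // e_sym.
have [e13|n13] := boolP (e x1 x3); have [e35|n35] := boolP (e x3 x5).
- by case: (bowtie_in_family P5); [| | | |constructor 3|constructor 4].
- by case: (triangle_in_family P5); [| | | |constructor 2|constructor 3].
(* The triangle sits at the other end, so the path is reversed. *)
- case: (triangle_in_family P5r); rewrite // 1?e_sym //;
    by [constructor 2 | constructor 3].
by constructor 1; apply: path5_in_G1 P5 _ _ _.
Qed.

End Paths.

(** * From the families back to the matching complex *)

Lemma family_connected_graph (T : finType) (e : rel T) req opt U w q s :
    symmetric e -> irreflexive e ->
    (exists v, embedded_family e req opt U v) ->
    all (fun p => 2 <= nth 0 w p.1 + nth 0 w p.2) (req ++ opt) ->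
    all (fun u => 2 <= nth 0 w u) U ->
    \sum_(i < 5) nth 0 w i.+1 <= 5 ->
    all (fun p => (0 < p.1 <= 5) && (0 < p.2 <= 5)) (q :: s) ->
    all (mem req) (q :: s) -> path disjoint_pairs q s ->
    all (fun p => has (disjoint_pairs p) (q :: s)) (req ++ opt) ->
    all (fun u => has (fun p => (u != p.1) && (u != p.2)) (q :: s)) U ->
  is_connected_graph (matching_complex e).
Proof.
move=> e_sym e_irr [v v_emb] w_edge w_U w_sum s_le5 /allP s_req s_path s_edge.
move=> s_U; split; first exact: embedded_dim_le1 v_emb w_edge w_U w_sum.
exact: embedded_connected v_emb s_le5 s_req s_path s_edge s_U.
Qed.

Theorem lemma3p6 (T : finType) (e : rel T)
    (e_sym : symmetric e) (e_irr : irreflexive e)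
    (e_conn : graph_connected e) (e_edges : 2 <= #|edge_set e|) :
  is_connected_graph (matching_complex e) <->
  [\/ in_G1 e, in_G2 e, in_G3 e | graph_iso e bowtie].
Proof.
split=> [[dim1 conn1]|]; first exact: connected_matching_families.
case=> [/in_family_embedded|/in_family_embedded|/in_family_embedded|
        /(graph_iso_embedded _ e_conn)] emb.
(* The weights double the ordinary vertex cover by 2 and 4. *)
- apply: (family_connected_graph (w := [:: 0; 0; 2; 0; 2; 0]) (q := (3, 4))
    (s := [:: (1, 2); (4, 5); (2, 3)]) _ _ emb) => //.
  by rewrite !big_ord_recl big_ord0.
(* Half weight on the triangle and full weight on 4. The walk returns to [(4, 5)] because [(2, 3)]
   and [(1, 3)] meet. *)
- apply: (family_connected_graph (w := [:: 0; 1; 1; 1; 2; 0]) (q := (3, 4))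
    (s := [:: (1, 2); (4, 5); (2, 3); (4, 5); (1, 3)]) _ _ emb) => //.
  by rewrite !big_ord_recl big_ord0.
(* Half weight everywhere; the walk steps between non-adjacent sides of the 5-cycle. *)
- apply: (family_connected_graph (w := [:: 0; 1; 1; 1; 1; 1]) (q := (1, 2))
    (s := [:: (3, 4); (5, 1); (2, 3); (4, 5)]) _ _ emb) => //.
  by rewrite !big_ord_recl big_ord0.
(* For the bowtie the matching complex is a tree with inner vertices [(1, 2)] and [(4, 5)], so the
   walk has to revisit them. *)
apply: (family_connected_graph (w := [:: 0; 1; 1; 1; 1; 1]) (q := (3, 4))
  (s := [:: (1, 2); (3, 5); (1, 2); (4, 5); (2, 3); (4, 5); (1, 3)])
  _ _ emb) => //.
by rewrite !big_ord_recl big_ord0.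
Qed.
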